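(* Let $(X,d)$ be a metric space. Then, writing $\rho\stackrel{u}{\sim}d$ when $\rho$ is a metric on $X$ uniformly equivalent to $d$, $$H(U_d(X))=\bigvee_{\rho\stackrel{u}{\sim}d}H(Lip_\rho(X))=\bigcap_{\rho\stackrel{u}{\sim}d}H(Lip_\rho(X)).$$
   Context: For a metric space $(X,d)$, $U_d(X)$ and $Lip_d(X)$ are the unital vector lattices of all real-valued uniformly continuous, respectively Lipschitz, functions on $X$. Two metrics $d,\rho$ on $X$ are uniformly equivalent if both identity maps $(X,d)\to(X,\rho)$ and $(X,\rho)\to(X,d)$ are uniformly continuous. A compactification (resp. realcompactification) of $X$ is a compact Hausdorff (resp. realcompact Tychonoff) space containing $X$ as a dense subspace; $\alpha_1X\le\alpha_2X$ means that there is a continuous map $\alpha_2X\to\alpha_1X$ leaving $X$ pointwise fixed, and $\bigvee$ is the supremum for this order. The Samuel compactification $s_dX$ is the smallest compactification of $X$ to which every bounded real-valued $d$-uniformly continuous function (equivalently, every bounded $d$-Lipschitz function) extends continuously; it depends only on the uniform equivalence class of $d$, so $s_\rho X=s_dX$ for $\rho\stackrel{u}{\sim}d$. Every $f\in U_d(X)$ has a unique continuous extension $f^*:s_dX\to\mathbb{R}\cup\{\infty\}$ (one-point compactification of $\mathbb{R}$). For $\mathcal{L}=U_d(X)$ or $\mathcal{L}=Lip_\rho(X)$ with $\rho\stackrel{u}{\sim}d$, $H(\mathcal{L})$ is the space of unital vector lattice homomorphisms $\mathcal{L}\to\mathbb{R}$ with the topology of pointwise convergence; it is identified with the subspace $H(\mathcal{L})=\{\xi\in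 s_dX: f^*(\xi)\neq\infty\text{ for all }f\in\mathcal{L}\}$ of $s_dX$, a realcompactification of $X$. The intersection is taken in $s_dX$, and equality with the supremum is up to equivalence of realcompactifications ($\alpha_1X\le\alpha_2X\le\alpha_1X$). *)

(* Defs.v *)
From HB Require Import structures.
From mathcomp Require Import all_boot all_order all_algebra.
From mathcomp Require Import all_classical all_reals all_analysis.
Set Implicit Arguments.
Unset Strict Implicit.
Unset Printing Implicit Defensive.
Import Order.TTheory GRing.Theory Num.Theory.
Import numFieldNormedType.Exports.
Local Open Scope classical_set_scope.
Local Open Scope ring_scope.

(* [X] carries exactly the topology induced by the injection [e]. *)
Definition embedding (X Y : topologicalType) (e : X -> Y) : Prop :=
  injective e /\
  forall A : set X, open A <-> exists2 B : set Y, open B & e @^-1` B = A.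

Record extension (X : topologicalType) := Extension {
  ext_space :> topologicalType ;
  ext_map : X -> ext_space }.
Arguments ext_map {X} e _.

Section Extensions.
Context {X : topologicalType}.
Implicit Types a b : extension X.

Definition dense_embedding a : Prop :=
  embedding (ext_map a) /\ dense (range (ext_map a)).

(* [a <= b]: a continuous map [b -> a] fixes [X] pointwise. *)
Definition ext_le a b : Prop :=
  exists2 h : b -> a, continuous h & forall x, h (ext_map b x) = ext_map a x.

Definition compactification a : Prop :=
  [/\ dense_embedding a, compact [set: a] & hausdorff_space a].

(* Closed subspaces of powers of the real line; they are Tychonoff. *)
Definition realcompact (R : realType) (Y : topologicalType) : Prop :=
  exists (I : Type) (j : Y -> {ptws I -> R}), embedding j /\ closed (range j).

Definition realcompactification (R : realType) a : Prop :=
  dense_embedding a /\ realcompact R a.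

(* Suprema in the preorder of realcompactifications of [X] are unique only up
   to equivalence, so being a supremum is a property of [s]. *)
Definition is_supremum (R : realType) (I : Type) (F : I -> extension X)
    (s : extension X) : Prop :=
  [/\ forall i, realcompactification R (F i),
      realcompactification R s,
      forall i, ext_le (F i) s &
      forall b, realcompactification R b ->
        (forall i, ext_le (F i) b) -> ext_le s b].

End Extensions.

Section Homomorphisms.
Context {R : realType} {X : topologicalType}.
Variable L : set (X -> R).

(* The operations of [L] are those of [X -> R], read off pointwise. *)
Definition vlattice_hom (phi : L -> R) : Prop :=
  [/\ forall u v w : L, (forall x, \val w x = \val u x + \val v x) ->
        phi w = phi u + phi v,
      forall (c : R) (u w : L), (forall x, \val w x = c * \val u x) ->
        phi w = c * phi u,
      forall u v w : L, (forall x, \val w x = Num.max (\val u x) (\val v x)) ->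
        phi w = Num.max (phi u) (phi v),
      forall u v w : L, (forall x, \val w x = Num.min (\val u x) (\val v x)) ->
        phi w = Num.min (phi u) (phi v) &
      forall u : L, (forall x, \val u x = 1) -> phi u = 1].

Definition hom_set : set {ptws L -> R} := [set phi | vlattice_hom phi].

Definition eval_at (x : X) : {ptws L -> R} := fun u => \val u x.

Lemma eval_at_hom x : eval_at x \in hom_set.
Proof.
apply/mem_set; split=> [u v w uvw|c u w cuw|u v w uvw|u v w uvw|u u1].
- exact: uvw.
- exact: cuw.
- exact: uvw.
- exact: uvw.
- exact: u1.
Qed.

(* [H L]: topology of pointwise convergence, [X] mapped in by evaluation. *)
Definition H : extension X :=
  @Extension X (set_type hom_set)
    (fun x => exist _ (eval_at x) (eval_at_hom x)).

End Homomorphisms.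

Section MetricSpace.
Context {R : realType} {X : metricType R}.
Implicit Type rho : X -> X -> R.

Definition is_metric rho : Prop :=
  [/\ forall x, rho x x = 0,
      forall x y, rho x y = 0 -> x = y,
      forall x y, rho x y = rho y x &
      forall x y z, rho x z <= rho x y + rho y z].

Definition unif_equiv rho : Prop :=
  [/\ is_metric rho,
      forall e, 0 < e -> exists2 d, 0 < d &
        forall x y : X, mdist x y < d -> rho x y < e &
      forall e, 0 < e -> exists2 d, 0 < d &
        forall x y : X, rho x y < d -> mdist x y < e].

Definition U : set (X -> R) := [set f | unif_continuous f].

Definition Lip rho : set (X -> R) :=
  [set f | exists K, forall x y, `|f x - f y| <= K * rho x y].

Definition extends_bounded_U (a : extension X) : Prop :=
  forall f : X -> R, U f -> bounded_fun f ->
    exists2 g : a -> R, continuous g & forall x, g (ext_map a x) = f x.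

Definition samuel_compactification (s : extension X) : Prop :=
  [/\ compactification s, extends_bounded_U s &
      forall a, compactification a -> extends_bounded_U a -> ext_le s a].

(* The extension [f^*] with values in the one-point compactification of [R],
   whose point at infinity is [None]; for [f] in [U] and [s] the Samuel
   compactification the set below is a singleton. *)
Definition star (s : extension X) (f : X -> R) :
    s -> one_point_compactification R :=
  xget (fun=> None)
    [set g : s -> one_point_compactification R |
      continuous g /\ forall x, g (ext_map s x) = Some (f x)].

Definition finite_points (s : extension X) (L : set (X -> R)) : set s :=
  [set xi | forall f, L f -> star f xi <> None].

(* [H L] is, over [X], the subspace [finite_points s L] of [s]. *)
Definition H_identified (s : extension X) (L : set (X -> R)) : Prop :=
  exists h : H L -> s,
    [/\ embedding h, forall x, h (ext_map (H L) x) = ext_map s x &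
        range h = @finite_points s L].

End MetricSpace.

Arguments U {R X}.
Arguments star {R X} s f _.
Arguments finite_points {R X} s L.
Arguments H_identified {R X} s L.

(* Main.v *)
Require Import Defs.
From mathcomp Require Import all_boot all_order all_algebra.
From mathcomp Require Import all_classical all_reals all_analysis.
From mathcomp Require Import ring lra.
Import Order.TTheory GRing.Theory Num.Theory.
Import numFieldNormedType.Exports.
Set Implicit Arguments.
Unset Strict Implicit.
Unset Printing Implicit Defensive.
Local Open Scope classical_set_scope.
Local Open Scope ring_scope.

(** Why the theorem holds.

    A unital vector lattice homomorphism on a unital vector lattice [L] of
    functions on [X] is the same thing as a limit, pointwise on [L], of the
    evaluations at the points of [X] along some proper filter of [X]
    ([cvg_hom], [hom_cvg]).  Given a homomorphism [phi], the sets [{g < 1}]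
    with [phi g < 1] are a base of such a filter: they are stable under
    intersection because [L] has maxima, and nonempty because [g >= 1] would
    force [phi g >= 1].  This makes [X] dense in [H L] and the homomorphisms a
    closed subset of the power of the line ([H_dense], [hom_set_closed]), and
    it turns any dense extension of [X] over which all functions in [L] extend
    continuously into one that lies above [H L] ([H_ext_le]).

    The metric content is one observation ([U_Lip]): a [d]-uniformly continuous
    [f] is Lipschitz for [rho x y = d x y + |f x - f y|], and this [rho] is a
    metric uniformly equivalent to [d].  Hence [U] is the union of the sets
    [Lip rho].  The equality of [finite_points s U] with the intersection of
    the [finite_points s (Lip rho)] follows at once.  So does the supremum:
    [H U] lies above each [H (Lip rho)] because [Lip rho] is contained in [U],
    and if a realcompactification [b] lies above all of them, then every [f] in
    [U] extends to [b], through the [rho] for which it is Lipschitz, so that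
    [b] lies above [H U].

    It remains to identify [H L] with [finite_points s L] for [L] equal to [U]
    or [Lip rho] ([H_is_finite_points]).  Every [f] in [U] has a continuous
    extension [star s f] to the Samuel compactification [s] ([star_exists]).
    A homomorphism [phi] is the limit of evaluations along a filter of [X];
    a cluster point [xi] of this filter in the compact space [s] satisfies
    [star s f xi = phi f] for all [f] in [L], and [xi] is unique as soon as
    functions in [L] that extend to [s] separate the points of [s].  For
    bounded functions in [U] the separation comes from the minimality of [s]:
    the homomorphisms on bounded uniformly continuous functions form a
    compactification, which must map onto [s] ([samuel_U_separation]).  For
    [Lip rho] it is enough that two sets on which some uniformly continuous [f]
    takes values far apart are at a positive [rho]-distance, so that the
    truncated [rho]-distance to one of them does not vanish on the other
    ([Lip_separation]). *)

(** * Traces of neighbourhoods on a dense subset *)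

(** The filter on the source through which a point [p] of the target is
    approached; when [e] is a dense embedding of [X] in an extension, limits
    along [trace e p] are the values at [p] of continuous extensions. *)
Definition trace (X Y : topologicalType) (e : X -> Y) (p : Y) : set_system X :=
  filter_from (nbhs p) (fun V => e @^-1` V).

Lemma trace_filter (X Y : topologicalType) (e : X -> Y) p : Filter (trace e p).
Proof.
apply: filter_from_filter; first by exists setT; exact: filterT.
by move=> A B nA nB; exists (A `&` B); first exact: filterI.
Qed.

Lemma trace_proper (X Y : topologicalType) (e : X -> Y) p :
  closure (range e) p -> ProperFilter (trace e p).
Proof.
move=> clp; apply: filter_from_proper; first exact: trace_filter.
by move=> V /clp[_ [[x _ <-] Vx]]; exists x.
Qed.

Lemma dense_closure (Y : topologicalType) (A : set Y) p : dense A -> closure A p.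
Proof.
move=> dA B; rewrite nbhsE => -[W [oW Wp] WB].
have [|q [Wq Aq]] := dA W _ oW; first by exists p.
by exists q; split=> //; exact: WB.
Qed.

Lemma trace_cvg (X Y : topologicalType) (e : X -> Y) p : e @ trace e p --> p.
Proof. by move=> V nV; exists V. Qed.

Lemma trace_continuous_cvg (X Y Z : topologicalType) (e : X -> Y) (g : Y -> Z) p :
  continuous g -> (g \o e) @ trace e p --> g p.
Proof.
move=> cg; have FT := trace_filter e p.
exact: (continuous_cvg FT (cg p) (@trace_cvg _ _ e p)).
Qed.

Lemma dense_continuous_eq (X Y Z : topologicalType) (e : X -> Y) (f g : Y -> Z) :
  hausdorff_space Z -> dense (range e) -> continuous f -> continuous g ->
  (forall x, f (e x) = g (e x)) -> f = g.
Proof.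
move=> hZ de cf cg fg; apply/funext => p.
have FP : ProperFilter (trace e p) by apply/trace_proper/dense_closure.
have fp := @trace_continuous_cvg _ _ _ e f p cf.
have gp := @trace_continuous_cvg _ _ _ e g p cg.
rewrite (_ : f \o e = g \o e) in fp; last exact/funext.
exact: (cvg_unique hZ fp gp).
Qed.

(** The last hypothesis says that the neighbourhoods of [e x], read back in [X],
    are fine enough, so that the topology of [X] is the one induced by [e]. *)
Lemma trace_embedding (X Y : topologicalType) (e : X -> Y) :
  injective e -> continuous e -> (forall x, trace e (e x) --> x) -> embedding e.
Proof.
move=> ie ce te; split=> // A; split=> [oA|[B oB <-]]; last first.
  by apply: open_comp => // x _; exact: ce.
(* Taking the union of all candidates avoids choosing one for each point. *)
exists (\bigcup_(B in [set B | open B /\ e @^-1` B `<=` A]) B).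
  by apply: bigcup_open => B [].
apply/seteqP; split=> [x [B [_ BA] Bx]|x Ax]; first exact: BA.
have [V] := te x A (open_nbhs_nbhs (conj oA Ax)).
rewrite nbhsE => -[B [oB Bx] BV] VA; exists B => //=; split=> //.
by move=> y By; apply: VA; exact: BV.
Qed.

Lemma cvg_cluster_eq (T : topologicalType) (F : set_system T) p q :
  hausdorff_space T -> F --> p -> cluster F q -> q = p.
Proof.
by move=> hT Fp /(cvg_cluster Fp) pq; apply/esym/hT.
Qed.

Lemma cluster_app (T Z : topologicalType) (F : set_system T) (g : T -> Z) p :
  {for p, continuous g} -> cluster F p -> cluster (g @ F) (g p).
Proof.
move=> cg clp A B FA nB.
by have [t [At Bt]] := clp _ _ FA (cg _ nB); exists (g t).
Qed.

Lemma ptws_cvgP (I : Type) (T : topologicalType) (F : set_system {ptws I -> T})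
    (f : {ptws I -> T}) : Filter F ->
  F --> f <-> forall i, (fun g : {ptws I -> T} => g i) @ F --> f i.
Proof.
move=> FF; rewrite cvg_sup; split=> fF i.
  have := fF i; rewrite cvg_image; last first.
    by rewrite eqEsubset; split=> v // _; exists (cst v).
  apply: cvg_trans => W /=; rewrite ?nbhs_simpl /fmap /= => [[W' + <-]].
  by apply: filterS => g W'g /=; exists g.
have Fi := fF i; rewrite cvg_image; last first.
  by rewrite eqEsubset; split=> v // _; exists (cst v).
move=> W nW; exists ((fun g : {ptws I -> T} => g i) @^-1` W); first exact: Fi.
by rewrite eqEsubset; split=> [_ [g Wg <-]//|v Wv]; exists (cst v).
Qed.

Lemma ptws_eval_continuous (I : Type) (T : topologicalType) (i : I) :
  continuous (fun g : {ptws I -> T} => g i).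
Proof. by move=> f; apply: (ptws_cvgP f (nbhs_filter f)).1. Qed.

Lemma ptws_box_compact (R : realType) (I : eqType) (a b : I -> R) :
  @compact {ptws I -> R} [set p | forall i, `[a i, b i]%classic (p i)].
Proof.
exact: (@tychonoff I (fun=> R : topologicalType) (fun i => `[a i, b i]%classic)
  (fun i => @segment_compact R (a i) (b i))).
Qed.

(** * Convergence in the one-point compactification *)

(** The injection of [Y] in its one-point compactification is open, hence
    reflects convergence to finite points. *)
Lemma cvg_of_cvg_some (Y : topologicalType) (T : Type) (F : set_system T)
    (f : T -> Y) y :
  (fun t => Some (f t) : one_point_compactification Y) @ F -->
    (Some y : one_point_compactification Y) -> f @ F --> y.
Proof.
move=> Fy V /one_point_compactification_some_nbhs/Fy.
rewrite /nbhs /= => FV; suff -> : f @^-1` V =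
  (fun t => Some (f t) : one_point_compactification Y) @^-1` (Some @` V) by [].
apply/seteqP; split=> [t /= Vt|t [_ /= Vt [<-]]//]; exact: imageP.
Qed.

Lemma opc_hausdorff (R : realType) :
  hausdorff_space (one_point_compactification R).
Proof.
apply: one_point_compactification_hausdorff; first exact: locally_compactR.
exact: norm_hausdorff.
Qed.

(** * Homomorphisms as limits of evaluations *)

Section Homs.
Context {R : realType} {X : topologicalType}.
Implicit Types (L : set (X -> R)).

Definition unital_vlattice L : Prop :=
  [/\ forall c, L (cst c),
      forall f g, L f -> L g -> L (fun x => f x + g x),
      forall c f, L f -> L (fun x => c * f x) &
      forall f g, L f -> L g -> L (fun x => Num.max (f x) (g x))].

(** All the identities that define a homomorphism hold for evaluations and
    involve finitely many functions and continuous operations, so they pass to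
    the limit. *)
Lemma cvg_hom L (F : set_system X) (phi : L -> R) : ProperFilter F ->
  (forall f : L, \val f @ F --> phi f) -> vlattice_hom phi.
Proof.
move=> FF Fphi.
have lim_eq (f : X -> R) (w : L) r : f @ F --> r ->
    (forall x, \val w x = f x) -> phi w = r.
  move=> Ff wf; apply: (cvg_unique (@norm_hausdorff _ _) (Fphi w)).
  by rewrite (_ : \val w = f) //; exact/funext.
split=> [u v w|c u w|u v w|u v w|u].
- by apply: lim_eq; exact: cvgD.
- by apply: lim_eq; apply: cvgM; [exact: cvg_cst|exact: Fphi].
- apply: lim_eq.
  exact: (continuous2_cvg _ (@max_continuous _ _ (_, _)) (Fphi u) (Fphi v)).
- apply: lim_eq.
  exact: (continuous2_cvg _ (@min_continuous _ _ (_, _)) (Fphi u) (Fphi v)).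
- by apply: lim_eq; exact: cvg_cst.
Qed.

(** Since [L] has maxima, single functions suffice for a base of the filter:
    [{g < 1}] and [{h < 1}] meet in [{max g h < 1}], and a finite family of
    conditions [|f x - phi f| < e] is of this form. *)
Lemma hom_cvg L (phi : L -> R) : unital_vlattice L -> vlattice_hom phi ->
  exists2 F : set_system X, ProperFilter F & forall f : L, \val f @ F --> phi f.
Proof.
move=> [Lc LD LM Lmax] [phiD phiM phimax _ phi1].
pose sub f (Lf : L f) : L := exist _ f (mem_set Lf).
have phic c : phi (sub _ (Lc c)) = c.
  rewrite (phiM c (sub _ (Lc 1))) ?phi1 ?mulr1// => x.
  by rewrite /= /cst mulr1.
pose F := filter_from [set g : L | phi g < 1] (fun g => [set x | \val g x < 1]).
have PF : ProperFilter F.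
  apply: filter_from_proper.
    apply: filter_from_filter.
      by exists (sub _ (Lc 0)); rewrite /= phic.
    move=> f g /= f1 g1.
    exists (sub _ (Lmax _ _ (set_valP f) (set_valP g))) => /=.
      by rewrite (phimax f g) // gt_max f1.
    by move=> x /=; rewrite gt_max => /andP.
  (* If [g >= 1] everywhere then [g = max g 1], whence [phi g >= 1]. *)
  move=> g /= g1; apply: contrapT => /forallNP g_ge1; move: g1; apply/negP.
  have gE x : \val g x = Num.max (\val g x) (\val (sub _ (Lc 1)) x).
    by apply/esym/max_idPl; rewrite /= leNgt; apply/negP/g_ge1.
  by rewrite -leNgt (phimax _ _ _ gE) phic le_max lexx orbT.
exists F => // f; apply/cvgrPdist_lt => e e0.
(* [phi] vanishes at [u = f - phi f] and [v = - u], hence at the maximum of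
   [u / e] and [v / e], which is less than 1 exactly where [|f - phi f| < e]. *)
pose u := sub _ (LD _ _ (set_valP f) (Lc (- phi f))).
pose v := sub _ (LM (-1) _ (set_valP u)).
have phiu : phi u = 0.
  by rewrite (phiD f (sub _ (Lc (- phi f))) u) // phic subrr.
have phiv : phi v = 0 by rewrite (phiM (-1) u) // phiu mulr0.
pose u' := sub _ (LM e^-1 _ (set_valP u)).
pose v' := sub _ (LM e^-1 _ (set_valP v)).
exists (sub _ (Lmax _ _ (set_valP u') (set_valP v'))) => /=.
  by rewrite (phimax u' v') // (phiM e^-1 u u') // (phiM e^-1 v v') //
    phiu phiv mulr0 maxxx.
move=> x /=; rewrite gt_max !ltr_pdivrMl // mulr1 mulN1r => /andP[ux vx].
by rewrite ltr_norml; apply/andP; split; lra.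
Qed.

Lemma H_eval_continuous L (f : L) : continuous (fun p : H L => \val p f).
Proof.
move=> p.
apply: (@continuous_comp (H L) {ptws L -> R} R (fun q => \val q) (@^~ f)).
  exact: (@initial_continuous (H L) {ptws L -> R} (fun q => \val q)).
exact: (@ptws_eval_continuous L R f).
Qed.

Lemma H_cvgP L (F : set_system (H L)) (p : H L) : Filter F ->
  (forall f : L, (fun q : H L => \val q f) @ F --> \val p f) -> F --> p.
Proof.
move=> FF Fp; have : (\val : H L -> {ptws L -> R}) @ F --> \val p.
  by apply/ptws_cvgP => f; exact: Fp.
move=> Fp' V [B [[W oW <-] Wp] WV].
apply: (filterS WV); apply: (Fp' W); exact: open_nbhs_nbhs.
Qed.

Lemma H_eq L (p q : H L) : (forall f : L, \val p f = \val q f) -> p = q.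
Proof. by move=> pq; apply/val_inj/funext. Qed.

(** The filter of [hom_cvg] converges to [p] in the topology of pointwise
    convergence. *)
Lemma H_dense L : unital_vlattice L -> dense (range (ext_map (H L))).
Proof.
move=> vL V [p Vp] oV.
have [F PF Fp] := hom_cvg vL (set_valP p).
have Fp' : ext_map (H L) @ F --> p by exact: H_cvgP.
have /filter_ex[x Vx] : F (ext_map (H L) @^-1` V).
  by apply: Fp'; exact: open_nbhs_nbhs.
by exists (ext_map (H L) x); split=> //; exists x.
Qed.

(** A point of the closure is still a limit of evaluations, by density, so
    [cvg_hom] applies to it. *)
Lemma hom_set_closed L : unital_vlattice L -> closed (@hom_set R X L).
Proof.
move=> vL p clp; have : closure (range (@eval_at R X L)) p.
  move=> V; rewrite nbhsE => -[W oWp WV].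
  have [phi [hphi Wphi]] := clp _ (open_nbhs_nbhs oWp); case: oWp => oW _.
  have [F PF Fphi] := hom_cvg vL hphi.
  have Fphi' : @eval_at R X L @ F --> phi by exact/ptws_cvgP.
  have /filter_ex[x Wx] : F (@eval_at R X L @^-1` W).
    by apply: Fphi'; exact: open_nbhs_nbhs.
  by exists (eval_at x); split; [exists x|exact: WV].
move=> /trace_proper PT; apply: (cvg_hom PT) => f.
exact: (trace_continuous_cvg _ (@ptws_eval_continuous L R f)).
Qed.

Lemma H_realcompact L : unital_vlattice L -> realcompact R (H L).
Proof.
move=> vL; exists L, (\val : H L -> {ptws L -> R}); split.
  by split=> //; exact: val_inj.
rewrite (_ : range _ = @hom_set R X L); first exact: hom_set_closed.
apply/seteqP; split=> [_ [p _ <-]|phi hphi]; first exact: (set_valP p).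
by exists (exist _ phi (mem_set hphi)).
Qed.

(** The last hypothesis provides the functions of [L] that recover the topology
    of [X]; in a metric space these are truncated multiples of the distance. *)
Lemma H_realcompactification L : unital_vlattice L ->
  accessible_space X -> (forall f, L f -> continuous f) ->
  (forall x V, nbhs x V -> exists g, [/\ L g, g x < 1 & forall y, g y < 1 -> V y]) ->
  realcompactification R (H L).
Proof.
move=> vL accX Lcont Lsep; split; last exact: H_realcompact.
split; last exact: H_dense.
apply: trace_embedding => [x y xy|x|x V nV].
- apply: contrapT => /eqP xNy; have [V [oV xV yV]] := accX _ _ xNy.
  have [|g [Lg gx gV]] := Lsep x V.
    by apply: open_nbhs_nbhs; split=> //; exact: set_mem.
  apply: (set_mem yV); apply: gV.
  have := congr1 (fun p : H L => \val p (exist _ g (mem_set Lg))) xy.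
  by rewrite /= /eval_at /= => <-.
- by apply: H_cvgP => f; exact: (Lcont _ (set_valP f)).
- have [g [Lg gx gV]] := Lsep x V nV.
  exists [set p : H L | \val p (exist _ g (mem_set Lg)) < 1]; last exact: gV.
  apply: (@H_eval_continuous L (exist _ g (mem_set Lg)) _ [set r | r < 1]).
  by apply: open_nbhs_nbhs; split=> //; exact: open_lt.
Qed.

(** The map sends [p] to the homomorphism that takes each function of [L] to
    the value at [p] of its extension: a limit of evaluations along
    [trace (ext_map a) p]. *)
Lemma H_ext_le L (a : extension X) : dense (range (ext_map a)) ->
  (forall f, L f -> exists2 g : a -> R, continuous g &
    forall x, g (ext_map a x) = f x) ->
  ext_le (H L) a.
Proof.
move=> da Lext.
have Lext' (f : L) : exists g : a -> R, continuous g /\ g \o ext_map a = \val f.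
  by have [g cg gf] := Lext _ (set_valP f); exists g; split=> //; exact/funext.
have [G HG] := choice Lext'.
have homG p : vlattice_hom (G ^~ p).
  have PT : ProperFilter (trace (ext_map a) p) by apply/trace_proper/dense_closure.
  apply: (cvg_hom PT) => f; have [cG <-] := HG f.
  exact: trace_continuous_cvg.
exists (fun p => exist _ (G ^~ p) (mem_set (homG p))).
  by move=> p; apply: H_cvgP => f; have [cG _] := HG f; exact: cG.
move=> x; apply: H_eq => f /=; have [_ /(congr1 (@^~ x))] := HG f.
by [].
Qed.

End Homs.

(** * Lattices of bounded functions *)

Section BoundedFunctions.
Context {R : realType} {X : topologicalType}.
Implicit Types (L : set (X -> R)) (f g : X -> R).

Lemma bounded_funE f : bounded_fun f <-> exists M, forall x, `|f x| <= M.
Proof.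
split=> [[M [_ fM]]|[M fM]].
  by exists (M + 1) => x; apply: (fM (M + 1)) => //; rewrite ltrDl.
exists M; split; first exact: num_real.
by move=> N /ltW MN x _; exact: le_trans (fM x) MN.
Qed.

Definition bounded_part L : set (X -> R) := [set f | L f /\ bounded_fun f].

Lemma bounded_part_vlattice L :
  unital_vlattice L -> unital_vlattice (bounded_part L).
Proof.
move=> [Lc LD LM Lmax]; split.
- by move=> c; split=> //; apply/bounded_funE; exists `|c|.
- move=> f g [Lf /bounded_funE[M fM]] [Lg /bounded_funE[N gN]].
  split; first exact: LD.
  apply/bounded_funE; exists (M + N) => x.
  by rewrite (le_trans (ler_normD _ _)) // lerD.
- move=> c f [Lf /bounded_funE[M fM]]; split; first exact: LM.
  by apply/bounded_funE; exists (`|c| * M) => x; rewrite normrM ler_wpM2l.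
- move=> f g [Lf /bounded_funE[M fM]] [Lg /bounded_funE[N gN]].
  split; first exact: Lmax.
  apply/bounded_funE; exists (Num.max M N) => x; rewrite le_max.
  by have [_|_] := leP (f x) (g x); rewrite ?fM ?gN ?orbT.
Qed.

Lemma H_hausdorff L : hausdorff_space (H L).
Proof.
move=> p q pq; apply: H_eq => f; apply/esym.
apply: (@cvg_cluster_eq R ((fun p : H L => \val p f) @ nbhs p)).
- exact: norm_hausdorff.
- exact: H_eval_continuous.
- exact: (cluster_app (@H_eval_continuous _ _ L f q)).
Qed.

(** Bounds of the functions of [L] confine the homomorphisms, a closed set, to a
    product of segments. *)
Lemma H_compact L : unital_vlattice L ->
  (forall f, L f -> bounded_fun f) -> compact [set: H L].
Proof.
move=> vL bL.
have bL' (f : L) : exists M : R, forall x, `|\val f x| <= M.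
  by have /bL/bounded_funE := set_valP f.
have [M HM] := choice bL'.
have chom : @compact {ptws L -> R} (@hom_set R X L).
  refine (@subclosed_compact _ _ _ (@hom_set_closed _ _ L vL)
    (@ptws_box_compact _ _ (fun i : L => - M i) M) _).
  move=> p hp f.
  have [F PF Fp] := hom_cvg vL hp.
  apply: (closed_cvg _ _ _ _ (Fp f)); first exact: itv_closed.
  by apply: nearW => x; rewrite /= in_itv /= -ler_norml HM.
move=> F PF _.
have [|p [hp clp]] := chom ((fun q : H L => \val q : {ptws L -> R}) @ F).
  by apply: nearW => q; exact: (set_valP q).
exists (exist _ p (mem_set hp)); split=> // A B FA [B' [[W oW <-] Wp] WB].
have [||_ [[q Aq <-] Wq]] := clp [set \val (q : H L) | q in A] W.
- by apply: (@filterS _ F _ A) FA => q Aq; exists q.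
- by exact: open_nbhs_nbhs.
- by exists q; split=> //; exact: WB.
Qed.

End BoundedFunctions.

(** * Uniformly continuous and Lipschitz functions *)

Section Metrics.
Context {R : realType} {X : metricType R}.
Implicit Types (L : set (X -> R)) (rho : X -> X -> R) (f g : X -> R).

Lemma U_P f : U f <-> forall e, 0 < e -> exists2 d, 0 < d &
  forall x y : X, mdist x y < d -> `|f x - f y| < e.
Proof.
rewrite /U /= unif_continuousP; split=> fU e e0.
  have [d d0 fd] := fU e e0; exists d => // x y xyd.
  by have := fd (x, y); rewrite ballEmdist; exact.
have [d d0 fd] := fU e e0; exists d => // -[x y] /=.
by rewrite ballEmdist; exact: fd.
Qed.

Lemma U_continuous f : U f -> continuous f.
Proof.
move=> /U_P fU x; apply/cvgrPdist_lt => e /fU[d d0 fd].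
have := nbhsx_ballx x d d0; rewrite ballEmdist.
by apply: filterS => y /= xyd; exact: fd.
Qed.

Lemma metric_ge0 rho x y : is_metric rho -> 0 <= rho x y.
Proof.
move=> [rho0 _ rhoC rhoD]; have := rhoD x y x.
by rewrite rho0 (rhoC y x); lra.
Qed.

Lemma Lip_U rho f : unif_equiv rho -> Lip rho f -> U f.
Proof.
move=> [mrho dr _] [K fK]; apply/U_P => e e0.
have K0 : 0 < `|K| + 1 by rewrite ltr_wpDl.
have [d d0 drd] := dr (e / (`|K| + 1)) (divr_gt0 e0 K0); exists d => // x y.
move=> /drd; rewrite ltr_pdivlMr // mulrC; apply: le_lt_trans.
apply: (le_trans (fK x y)); apply: ler_wpM2r; first exact: metric_ge0.
by rewrite (le_trans (ler_norm K)) // lerDl.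
Qed.

Lemma max_dist_le (a b c d : R) :
  `|Num.max a b - Num.max c d| <= `|a - c| + `|b - d|.
Proof.
have := ler_norm (a - c); have := ler_norm (b - d).
have := lerNnormlW (lexx `|a - c|); have := lerNnormlW (lexx `|b - d|).
rewrite ler_norml; case: (leP a b); case: (leP c d) => *; apply/andP; split; lra.
Qed.

Lemma min1_dist_le (a b : R) : `|Num.min 1 a - Num.min 1 b| <= `|a - b|.
Proof.
have := ler_norm (a - b); have := lerNnormlW (lexx `|a - b|).
rewrite ler_norml; case: (leP 1 a); case: (leP 1 b) => *; apply/andP; split; lra.
Qed.

Lemma Lip_vlattice rho : unital_vlattice (Lip rho).
Proof.
split.
- by move=> c; exists 0 => x y; rewrite subrr normr0 mul0r.
- move=> f g [K fK] [M gM]; exists (K + M) => x y; rewrite mulrDl opprD addrACA.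
  by rewrite (le_trans (ler_normD _ _)) // lerD.
- move=> c f [K fK]; exists (`|c| * K) => x y.
  by rewrite -mulrBr normrM -mulrA ler_wpM2l.
- move=> f g [K fK] [M gM]; exists (K + M) => x y; rewrite mulrDl.
  by rewrite (le_trans (max_dist_le _ _ _ _)) // lerD.
Qed.

(** The added terms make [f] and [g] 1-Lipschitz, and they are small for points
    that are close for [mdist] because [f] and [g] are uniformly continuous.
    Taking two functions at once lets [U] inherit the lattice operations from
    [Lip rho]. *)
Lemma U_Lip f g : U f -> U g ->
  exists rho, [/\ unif_equiv rho, Lip rho f & Lip rho g].
Proof.
move=> /U_P fU /U_P gU.
exists (fun x y => mdist x y + (`|f x - f y| + `|g x - g y|)); split.
- split.
  + split=> [x|x y|x y|x y z].
    * by rewrite mdistxx !subrr normr0 !addr0.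
    * move=> xy0; apply: mdist_positivity; apply: le_anti.
      by rewrite mdist_ge0 -xy0 lerDl addr_ge0.
    * by rewrite metric_sym (distrC (f x)) (distrC (g x)).
    * have := metric_triangle x y z.
      have := ler_distD (f y) (f x) (f z); have := ler_distD (g y) (g x) (g z).
      lra.
  + move=> e e0; have e3 : 0 < e / 3 by rewrite divr_gt0.
    have [d d0 fd] := fU _ e3; have [d' d'0 gd'] := gU _ e3.
    exists (Num.min (e / 3) (Num.min d d')); first by rewrite !lt_min e3 d0.
    move=> x y; rewrite !lt_min => /and3P[xye /fd fxy /gd' gxy]; lra.
  + move=> e e0; exists e => // x y; apply: le_lt_trans.
    by rewrite lerDl addr_ge0.
- exists 1 => x y; rewrite mul1r.
  have := mdist_ge0 x y; have := normr_ge0 (g x - g y); lra.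
- exists 1 => x y; rewrite mul1r.
  have := mdist_ge0 x y; have := normr_ge0 (f x - f y); lra.
Qed.

Lemma U_vlattice : unital_vlattice (@U R X).
Proof.
split.
- by move=> c; apply/U_P => e e0; exists 1 => // x y _; rewrite subrr normr0.
- move=> f g fU gU; have [rho [urho fL gL]] := U_Lip fU gU.
  by apply: (Lip_U urho); case: (Lip_vlattice rho) => _ + _ _; exact.
- move=> c f fU; have [rho [urho fL _]] := U_Lip fU fU.
  by apply: (Lip_U urho); case: (Lip_vlattice rho) => _ _ + _; exact.
- move=> f g fU gU; have [rho [urho fL gL]] := U_Lip fU gU.
  by apply: (Lip_U urho); case: (Lip_vlattice rho) => _ _ _; exact.
Qed.

(** A ball for [rho] of radius [d] around [x] lies in [V], and [rho x y / d] is
    less than 1 exactly on that ball; truncation at 1 makes it bounded, so that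
    it serves for bounded functions as well. *)
Lemma Lip_bump rho x V : unif_equiv rho -> nbhs x V ->
  exists g, [/\ bounded_part (Lip rho) g, g x < 1 & forall y, g y < 1 -> V y].
Proof.
move=> [mrho _ rd] /nbhs_ballP[e e0 eV].
have [d d0 rdd] := rd e e0.
have [rho0 _ rhoC rhoD] := mrho.
exists (fun y => Num.min 1 (d^-1 * rho x y)); split.
- split.
    exists d^-1 => y z; apply: (le_trans (min1_dist_le _ _)).
    rewrite -mulrBr normrM gtr0_norm ?invr_gt0 //.
    apply: ler_wpM2l; first by rewrite invr_ge0 ltW.
    have := rhoD x y z; have := rhoD x z y; rewrite (rhoC z y) => h1 h2.
    by rewrite ler_norml; apply/andP; split; lra.
  apply/bounded_funE; exists 1 => y.
  have ge0 : 0 <= d^-1 * rho x y.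
    by rewrite mulr_ge0 ?metric_ge0 // invr_ge0 ltW.
  by rewrite ger0_norm ?ge_min ?lexx // le_min ler01.
- by rewrite rho0 mulr0 gt_min ltr01 orbT.
- move=> y; rewrite gt_min ltxx /= ltr_pdivrMl // mulr1 => xyd.
  by apply: eV; rewrite ballEmdist; exact: rdd.
Qed.

Lemma H_metric_realcompactification L rho : unital_vlattice L ->
  unif_equiv rho -> bounded_part (Lip rho) `<=` L -> L `<=` U ->
  realcompactification R (H L).
Proof.
move=> vL urho rhoL LU; apply: H_realcompactification => //.
- by apply/hausdorff_accessible/metric_hausdorff.
- by move=> f /LU/U_continuous.
- move=> x V nV; have [g [gL gx gV]] := Lip_bump urho nV.
  by exists g; split=> //; exact: rhoL.
Qed.

(** Uniform continuity keeps the points where [f < a] at some [rho]-distance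
    [e > 0] from those where [b < f]; the function [k] is the [rho]-distance,
    truncated at 1, to the set where [f < a]. *)
Lemma Lip_separation rho f (a b : R) : unif_equiv rho -> U f -> a < b ->
  exists k c, [/\ bounded_part (Lip rho) k, 0 < c,
    forall x, f x < a -> k x = 0 & forall x, b < f x -> c <= k x].
Proof.
move=> urho /U_P fU ab; have [mrho _ rd] := urho.
have [A0|/forallNP A0] := pselect (exists x, f x < a); last first.
  (* The infimum below is over an empty set here; a constant does instead. *)
  exists (cst 1), 1; split=> // [|x /A0//].
  by have [+ _ _ _] := bounded_part_vlattice (Lip_vlattice rho); exact.
have ba0 : 0 < b - a by rewrite subr_gt0.
have [d d0 fd] := fU _ ba0; have [e e0 re] := rd d d0.
have [rho0 _ rhoC rhoD] := mrho.
pose S x := [set Num.min 1 (rho x y) | y in [set y | f y < a]].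
have S0 x : S x !=set0 by have [y fy] := A0; exists (Num.min 1 (rho x y)), y.
have Sge0 x : lbound (S x) 0.
  by move=> _ [y _ <-]; rewrite le_min ler01 metric_ge0.
have infle x y : f y < a -> inf (S x) <= Num.min 1 (rho x y).
  by move=> fy; apply: ge_inf; [exists 0|exists y].
exists (fun x => inf (S x)), (Num.min 1 e); split.
- split.
    suff Sle x y : inf (S x) <= inf (S y) + rho x y.
      exists 1 => x y; rewrite mul1r ler_norml.
      have := Sle x y; have := Sle y x; rewrite (rhoC y x) => *.
      by apply/andP; split; lra.
    rewrite -lerBlDr; apply: lb_le_inf => // _ [z fz <-].
    rewrite lerBlDr (le_trans (infle x z fz)) //.
    have := rhoD x y z; have := metric_ge0 x y mrho.
    by case: (leP 1 (rho x z)); case: (leP 1 (rho y z)) => *; lra.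
  apply/bounded_funE; exists 1 => x.
  have [y fy] := A0; rewrite ger0_norm; last exact: lb_le_inf.
  by rewrite (le_trans (infle x y fy)) // ge_min lexx.
- by rewrite lt_min ltr01.
- move=> x fx; apply: le_anti; rewrite lb_le_inf // andbT.
  by rewrite (le_trans (infle x x fx)) // rho0 ge_min lexx orbT.
- move=> x fx; apply: lb_le_inf => // _ [y /= fy <-].
  rewrite le_min ge_min lexx /= ge_min; apply/orP; right.
  rewrite leNgt; apply/negP => /re/fd.
  by rewrite ltNge (le_trans _ (ler_norm _)) //; lra.
Qed.

(** For a [rho] that makes [f] Lipschitz, [phi \o f] is Lipschitz too. *)
Lemma U_comp_lipschitz (phi : R -> R) (C : R) f :
  (forall r t, `|phi r - phi t| <= C * `|r - t|) -> U f -> U (phi \o f).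
Proof.
move=> phiC Uf; have [rho [urho [K fK] _]] := U_Lip Uf Uf.
apply: (Lip_U urho); exists (`|C| * K) => x y /=.
apply: (le_trans (phiC _ _)); rewrite -mulrA.
apply: (le_trans (ler_wpM2r (normr_ge0 _) (ler_norm C))).
exact: ler_wpM2l.
Qed.

Lemma mdist_unif_equiv : unif_equiv (@mdist R X).
Proof.
split; [split| |]; last 2 first.
- by move=> e e0; exists e.
- by move=> e e0; exists e.
- exact: mdistxx.
- exact: mdist_positivity.
- exact: metric_sym.
- by move=> x y z; exact: metric_triangle.
Qed.

Lemma bounded_part_Lip_U rho : unif_equiv rho ->
  bounded_part (Lip rho) `<=` bounded_part U.
Proof. by move=> urho f [/(Lip_U urho)]. Qed.

End Metrics.

(** * Separation and extension over the Samuel compactification *)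

Section Samuel.
Context {R : realType} {X : metricType R}.
Implicit Types (f : X -> R) (rho : X -> X -> R).

Variable s : extension X.
Hypothesis samuel_s : samuel_compactification s.

Let e : X -> s := ext_map s.

Let dense_e : dense (range e).
Proof. by case: samuel_s => -[[]]. Qed.

Let compact_s : compact [set: s].
Proof. by case: samuel_s => -[]. Qed.

Let hausdorff_s : hausdorff_space s.
Proof. by case: samuel_s => -[]. Qed.

Let trace_e p : ProperFilter (trace e p).
Proof. exact/trace_proper/dense_closure. Qed.

(** Bounded uniformly continuous functions separate the points of their own
    homomorphism space, which is a compactification of [X] to which they all
    extend; by minimality it maps continuously to [s], and onto because its
    image is compact and contains [X]. *)
Lemma samuel_U_separation xi eta : xi <> eta -> exists f g,
  [/\ U f, continuous g, forall x, g (e x) = f x & g xi <> g eta].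
Proof.
move=> xieta; have [_ ext_s min_s] := samuel_s.
pose BU := bounded_part (@U R X).
have vBU : unital_vlattice BU by apply/bounded_part_vlattice/U_vlattice.
have [rcH _] : realcompactification R (H BU).
  apply: (H_metric_realcompactification vBU mdist_unif_equiv).
    exact/bounded_part_Lip_U/mdist_unif_equiv.
  by move=> f [].
have cH : compact [set: H BU] by apply: H_compact => // f [].
have [||h ch he] := min_s (H BU).
- by split=> //; exact: H_hausdorff.
- move=> f Uf bf; pose f' : BU := exist _ f (mem_set (conj Uf bf)).
  by exists (fun p => \val p f'); first exact: H_eval_continuous.
have hsurj q : exists p, h p = q.
  have : closed (range h).
    apply: (compact_closed hausdorff_s); apply: continuous_compact => //.
    exact: continuous_subspaceT.
  have eh : range e `<=` range h.
    by move=> _ [x _ <-]; exists (ext_map (H BU) x).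
  by move=> /(_ q (closureS eh (dense_closure (p := q) dense_e)))[p _ <-]; exists p.
have [p hp] := hsurj xi; have [q hq] := hsurj eta.
have /existsNP[f fpq] : ~ forall f : BU, \val p f = \val q f.
  by move=> /H_eq pq; apply: xieta; rewrite -hp -hq pq.
have [Uf bf] := set_valP f; have [g cg gf] := ext_s _ Uf bf.
exists (\val f), g; split=> //.
have gh : g \o h = (fun p => \val p f).
  apply: (dense_continuous_eq (e := ext_map (H BU))).
  - exact: norm_hausdorff.
  - by case: rcH.
  - by move=> r; apply: continuous_comp; [exact: ch|exact: cg].
  - exact: H_eval_continuous.
  - by move=> x; rewrite /= he gf.
have := congr1 (@^~ p) gh; have := congr1 (@^~ q) gh.
by rewrite /= hp hq => -> ->.
Qed.

(** The separating function [f] of [samuel_U_separation] is replaced by a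
    Lipschitz one that vanishes where [f] is small and stays away from 0 where
    [f] is large; these values persist at [xi] and [eta]. *)
Lemma samuel_Lip_separation rho xi eta : unif_equiv rho -> xi <> eta ->
  exists f g, [/\ bounded_part (Lip rho) f, continuous g,
    forall x, g (e x) = f x & g xi <> g eta].
Proof.
move=> urho xieta; have [f [g [Uf cg gf gxieta]]] := samuel_U_separation xieta.
wlog glt : xi eta xieta gxieta / g xi < g eta.
  move=> wl; have [/wl|/wl|//] := ltgtP (g xi) (g eta); first exact.
  move=> /(_ (nesym xieta) (nesym gxieta))[k [l [Lk cl lk lxe]]].
  by exists k, l; split=> //; exact: nesym.
(* Two thresholds strictly between [g xi] and [g eta]: [f] is below the first
   one near [xi] and above the second one near [eta]. *)
pose d := (g eta - g xi) / 3.
have d0 : 0 < d by rewrite divr_gt0 // subr_gt0.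
have ab : g xi + d < g eta - d by rewrite /d; lra.
have [k [c [Lk c0 k0 kc]]] := Lip_separation urho Uf ab.
have [Uk bk] := bounded_part_Lip_U urho Lk.
have [_ ext_s _] := samuel_s; have [l cl lk] := ext_s _ Uk bk.
exists k, l; split=> //.
have kcvg p : k @ trace e p --> l p.
  rewrite (_ : k = l \o e); last by apply/funext => x; rewrite /= lk.
  exact: trace_continuous_cvg.
have PT p := trace_e p.
have -> : l xi = 0.
  apply: (closed_cvg [set r | r = 0] _ _ _ (kcvg xi)).
    exact: closed_eq.
  exists [set p | g p < g xi + d]; last by move=> x /=; rewrite gf => /k0.
  apply: (cg xi [set r | r < g xi + d]).
  by apply: open_nbhs_nbhs; split; [exact: open_lt|rewrite /= ltrDl].
have : c <= l eta.
  apply: (closed_cvg (fun r => c <= r) _ _ _ (kcvg eta)); first exact: closed_ge.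
  exists [set p | g eta - d < g p]; last by move=> x /=; rewrite gf => /kc.
  apply: (cg eta [set r | g eta - d < r]).
  by apply: open_nbhs_nbhs; split; [exact: open_gt|rewrite /= gtrBl].
by move=> /(lt_le_trans c0) + /esym l0; rewrite l0 ltxx.
Qed.

(** Both [h = 1 / (1 + |f|)] and [k = f / (1 + |f|)] are bounded and uniformly
    continuous, so they extend to [s], where [|k| + h = 1] persists by density.
    The extension of [f] is [k / h], infinite exactly where [h] vanishes; near
    such a point [|k|] is close to 1 and [k / h] leaves every compact set. *)
Lemma star_exists f : U f -> exists g : s -> one_point_compactification R,
  continuous g /\ forall x, g (e x) = Some (f x).
Proof.
move=> Uf; have [_ ext_s _] := samuel_s.
pose u (r : R) := (1 + `|r|)^-1.
have pos (r : R) : 0 < 1 + `|r| by rewrite ltr_pwDl.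
have neq0 (r : R) : 1 + `|r| != 0 by rewrite gt_eqF.
have u01 r : 0 < u r <= 1.
  by rewrite invr_gt0 pos invf_le1 ?pos // lerDl normr_ge0.
have uD r t : u r - u t = (`|t| - `|r|) * (u r * u t).
  by rewrite /u; field; rewrite !neq0.
have ulip r t : `|u r - u t| <= 1 * `|r - t|.
  rewrite uD normrM mul1r -[leRHS]mulr1 ler_pM //.
    by rewrite distrC ler_dist_dist.
  have /andP[ur ur1] := u01 r; have /andP[ut ut1] := u01 t.
  by rewrite gtr0_norm ?mulr_gt0 // mulr_ile1 // ltW.
have tu1 t : `|t * u t| <= 1.
  have /andP[ut _] := u01 t.
  by rewrite normrM (gtr0_norm ut) ler_pdivrMr // mul1r lerDr.
have vlip r t : `|r * u r - t * u t| <= 2 * `|r - t|.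
  have -> : r * u r - t * u t = (r - t) * u r + t * u t * ((`|t| - `|r|) * u r).
    rewrite -mulrA [u t * _]mulrC -mulrA -uD; ring.
  have /andP[ur ur1] := u01 r.
  rewrite (le_trans (ler_normD _ _)) // mulr_natl mulr2n lerD //.
    by rewrite normrM (gtr0_norm ur) ler_piMr.
  rewrite normrM -[leRHS]mul1r ler_pM //.
  rewrite normrM (gtr0_norm ur) -[leRHS]mulr1 ler_pM //; first exact: ltW.
  by rewrite distrC ler_dist_dist.
have bu : bounded_fun (u \o f).
  apply/bounded_funE; exists 1 => x; have /andP[ux ux1] := u01 (f x).
  by rewrite gtr0_norm.
have bv : bounded_fun ((fun r => r * u r) \o f).
  by apply/bounded_funE; exists 1 => x; exact: tu1.
have [h ch hu] := ext_s _ (U_comp_lipschitz ulip Uf) bu.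
have [k ck kv] := ext_s _ (U_comp_lipschitz vlip Uf) bv.
have kh1 p : `|k p| + h p = 1.
  have cc : continuous (fun _ : s => 1 : R) by move=> q; exact: cvg_cst.
  have ckh : continuous (fun p => `|k p| + h p).
    by move=> q; apply: cvgD; [apply: cvg_norm; exact: ck|exact: ch].
  suff /(congr1 (@^~ p)) : (fun p => `|k p| + h p) = (fun _ => 1) by [].
  apply: (dense_continuous_eq (@norm_hausdorff _ _) dense_e ckh cc) => x.
  rewrite hu kv /= normrM (gtr0_norm (x := u _)); last by have /andP[] := u01 (f x).
  by rewrite -[X in _ + X]mul1r -mulrDl addrC mulfV.
exists (fun p => if h p == 0 then None else Some (k p / h p)); split; last first.
  move=> x; have /andP[ux _] := u01 (f x).
  by rewrite hu kv /= gt_eqF //= mulfK // gt_eqF.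
move=> p; have [hp0|hp0] := eqVneq (h p) 0; last first.
  have near_h : \forall q \near p, h q != 0 by apply: (cvgr_neq0 _ (ch p)).
  have khp : (fun q => k q / h q) @ p --> k p / h p.
    by apply: cvgM; [exact: ck|apply: cvgV => //; exact: ch].
  rewrite /continuous_at (negbTE hp0).
  have Skhp := continuous_cvg (nbhs_filter p)
    (@one_point_compactification_some_continuous R (k p / h p)) khp.
  move=> W nW; apply: filterS (filterI near_h (Skhp W nW)) => q [hq] /=.
  by rewrite (negbTE hq).
rewrite /continuous_at hp0 eqxx => W [C [cC _] CW].
have [M [_ CM]] := compact_bounded cC.
(* With [M] a bound of the compact set [C]: a finite value [k q / h q] in [C]
   gives [1 = |k q| + h q <= (|M| + 2) |h q|], so [h q] cannot be small. *)
have N0 : 0 < `|M| + 2 by rewrite ltr_wpDl.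
have nearh : \forall q \near p, `|h q| < (`|M| + 2)^-1.
  have /cvgrPdist_lt/(_ (`|M| + 2)^-1) := ch p.
  rewrite invr_gt0 hp0 => /(_ N0); apply: filterS => q.
  by rewrite sub0r normrN.
apply: filterS nearh => q; rewrite -[ltRHS]mulr1 ltr_pdivlMl // => hq.
apply: CW => /=; have [hq0|hq0] := eqVneq (h q) 0; first by right.
left; exists (k q / h q) => //= Cq.
have kqh : `|k q / h q| <= `|M| + 1.
  by apply: (CM (`|M| + 1)) => //; rewrite (le_lt_trans (ler_norm M)) // ltrDl.
move: kqh; rewrite normrM normfV ler_pdivrMr ?normr_gt0 // => kqh.
have := kh1 q; have := ler_norm (h q); nra.
Qed.

(** * Homomorphisms as points of the Samuel compactification *)

Lemma star_spec f : U f ->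
  continuous (star s f) /\ forall x, star s f (e x) = Some (f x).
Proof.
move=> /star_exists ex_star; rewrite /star; case: xgetP => [_ -> //|none].
by have [g gf] := ex_star; have := none g gf.
Qed.

Lemma star_unique f (g : s -> one_point_compactification R) : U f ->
  continuous g -> (forall x, g (e x) = Some (f x)) -> star s f = g.
Proof.
move=> /star_spec[cf starf] cg gf.
apply: (dense_continuous_eq (@opc_hausdorff R) dense_e cf cg) => x.
by rewrite starf gf.
Qed.

Lemma star_trace_cvg f xi r : U f -> star s f xi = Some r -> f @ trace e xi --> r.
Proof.
move=> /star_spec[cf starf] fxi.
apply: (@cvg_of_cvg_some R X (trace e xi) f r).
rewrite -fxi (_ : (fun t => _) = star s f \o e).
  exact: trace_continuous_cvg.
by apply/funext => x; rewrite /= starf.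
Qed.

Section Identification.
Variable L : set (X -> R).
Hypothesis vL : unital_vlattice L.
Hypothesis LU : L `<=` U.
Hypothesis L_separates : forall xi eta, xi <> eta -> exists f (g : s -> R),
  [/\ L f, continuous g, forall x, g (e x) = f x & g xi <> g eta].

Let starL_continuous (f : L) : continuous (star s (\val f)).
Proof. exact: (star_spec (LU (set_valP f))).1. Qed.

Lemma star_separates xi eta :
  (forall f : L, star s (\val f) xi = star s (\val f) eta) -> xi = eta.
Proof.
move=> fxe; apply: contrapT => /L_separates[f [g [Lf cg gf]]]; apply.
have starg : star s f = Some \o g.
  apply: (star_unique (LU Lf)) => [p|x]; last by rewrite /= gf.
  apply: continuous_comp; first exact: cg.
  exact: one_point_compactification_some_continuous.
by have := fxe (exist _ f (mem_set Lf)); rewrite /= starg => -[].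
Qed.

(** All cluster points of [F] have the same finite values of [star s f] for [f]
    in [L], so they coincide; a filter on a compact Hausdorff space with a
    single cluster point converges to it. *)
Lemma star_cvg_point (F : set_system s) (phi : L -> R) : ProperFilter F ->
  (forall f : L, star s (\val f) @ F -->
     (Some (phi f) : one_point_compactification R)) ->
  exists2 xi, F --> xi & forall f : L, star s (\val f) xi = Some (phi f).
Proof.
move=> PF Fphi.
have cl xi : cluster F xi -> forall f : L, star s (\val f) xi = Some (phi f).
  move=> clxi f; apply: (cvg_cluster_eq (@opc_hausdorff R) (Fphi f)).
  exact: (cluster_app (@starL_continuous f xi)).
have [xi [_ clxi]] := compact_s PF filterT.
exists xi; last exact: cl.
apply: (compact_cluster_set1 hausdorff_s compact_s filterT PF filterT).
apply/seteqP; split=> [eta cleta|_ ->//].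
by apply: star_separates => f; rewrite (cl xi) // (cl eta).
Qed.

Lemma H_point (p : H L) :
  exists xi, forall f : L, star s (\val f) xi = Some (\val p f).
Proof.
have [F PF Fp] := hom_cvg vL (set_valP p).
have [|xi _ xip] := @star_cvg_point (e @ F) (\val p); last by exists xi.
move=> f; have [_ starf] := star_spec (LU (set_valP f)).
have starE : star s (\val f) \o e = Some \o \val f.
  by apply/funext => x; rewrite /= starf.
have Sf := continuous_cvg (@filter_filter _ _ PF)
  (@one_point_compactification_some_continuous R (\val p f)) (Fp f).
by rewrite -starE in Sf; exact: Sf.
Qed.

(** The map [h] sends a homomorphism to the limit in [s] of its filter of
    evaluations; a finite point [xi] comes from the homomorphism given by limits
    along [trace e xi].  Both topologies are determined by the values of the
    functions of [L], the one of [s] because a filter along which these values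
    converge to finite limits converges, so [h] is an embedding. *)
Lemma H_is_finite_points : H_identified s L.
Proof.
have [h hstar] := choice H_point.
have hx x : h (ext_map (H L) x) = e x.
  apply: star_separates => f; rewrite hstar /=.
  by rewrite (star_spec (LU (set_valP f))).2.
have h_comp (f : L) : star s (\val f) \o h = Some \o (fun p : H L => \val p f).
  by apply/funext => p; rewrite /= hstar.
exists h; split=> //.
- apply: trace_embedding.
  + move=> p q hpq; apply: H_eq => f.
    by have := hstar p f; rewrite hpq hstar => -[].
  + move=> p; have PF : ProperFilter (h @ nbhs p) :=
      fmap_proper_filter h (nbhs_pfilter p).
    have [|xi hpxi xip] := star_cvg_point PF (phi := \val p).
      move=> f; have Sf := continuous_cvg (nbhs_filter p)
        (@one_point_compactification_some_continuous R (\val p f))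
        (@H_eval_continuous _ _ _ f p).
      by rewrite -h_comp in Sf; exact: Sf.
    have hp : h p = xi by apply: star_separates => f; rewrite hstar xip.
    by rewrite /continuous_at hp.
  + move=> p; have FT := trace_filter h (h p).
    apply: H_cvgP => f; apply: cvg_of_cvg_some.
    rewrite -(hstar p f) -[X in (X @ _)]/(Some \o (fun q : H L => \val q f)).
    by rewrite -h_comp; exact: trace_continuous_cvg.
- apply/seteqP; split=> [_ [p _ <-] f Lf|xi finxi].
    by have := hstar p (exist _ f (mem_set Lf)); rewrite /= => ->.
  have Lfin (f : L) : exists r, star s (\val f) xi = Some r.
    by case: (star s (\val f) xi) (finxi _ (set_valP f)) => // r; exists r.
  have [phi phixi] := choice Lfin.
  have hphi : vlattice_hom phi.
    have PT := trace_e xi.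
    apply: (cvg_hom PT) => f; apply: star_trace_cvg => //.
    exact: (LU (set_valP f)).
  exists (exist _ phi (mem_set hphi)) => //.
  by apply: star_separates => f; rewrite hstar phixi.
Qed.

End Identification.

End Samuel.

(** * The supremum and the intersection *)

Theorem theorem20 (R : realType) (X : metricType R) (s : extension X)
    (samuel_s : samuel_compactification s) :
  [/\ H_identified s U /\
        (forall rho : X -> X -> R, unif_equiv rho -> H_identified s (Lip rho)),
      is_supremum R
        (fun rho : {rho : X -> X -> R | unif_equiv rho} => H (Lip (sval rho)))
        (H U) &
      finite_points s U =
        \bigcap_(rho in [set rho : X -> X -> R | unif_equiv rho])
          finite_points s (Lip rho)].
Proof.
have rcU : realcompactification R (H (@U R X)).
  apply: (H_metric_realcompactification (@U_vlattice R X) mdist_unif_equiv) => //.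
  by move=> f /(bounded_part_Lip_U mdist_unif_equiv)[].
split.
- split=> [|rho urho].
    apply: H_is_finite_points => //; first exact: U_vlattice.
    move=> xi eta /(samuel_U_separation samuel_s)[f [g [Uf cg gf gxe]]].
    by exists f, g.
  apply: H_is_finite_points => //; first exact: Lip_vlattice.
    by move=> f; exact: Lip_U.
  move=> xi eta.
  move=> /(samuel_Lip_separation samuel_s urho)[f [g [[Lf _] cg gf gxe]]].
  by exists f, g.
- split=> //.
  + move=> [rho urho] /=.
    apply: (H_metric_realcompactification (Lip_vlattice rho) urho).
      by move=> f [].
    by move=> f; exact: Lip_U.
  + move=> [rho urho] /=; apply: H_ext_le; first by case: rcU => -[].
    move=> f Lf; pose f' : U := exist _ f (mem_set (Lip_U urho Lf)).
    by exists (fun p : H U => \val p f'); first exact: H_eval_continuous.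
  + move=> b [[_ db] _] Lipb; apply: H_ext_le => // f Uf.
    have [rho [urho Lf _]] := U_Lip Uf Uf.
    have [h ch hx] := Lipb (exist _ rho urho).
    pose f' : Lip rho := exist _ f (mem_set Lf).
    exists (fun q => \val (h q) f'); last by move=> x; rewrite hx.
    move=> q.
    exact: (@continuous_comp b (H (Lip rho)) R h (fun p => \val p f') q
              (ch q) (@H_eval_continuous _ _ _ f' _)).
- apply/seteqP; split=> [xi finxi rho urho f Lf|xi finxi f Uf].
    by apply: finxi; exact: Lip_U urho Lf.
  by have [rho [urho Lf _]] := U_Lip Uf Uf; exact: finxi urho _ Lf.
Qed.
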